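(* Let $\mathcal{A} \subseteq B(\mathcal{H})$ be a hereditarily antisymmetric dual operator algebra. If the transitive algebra problem has a positive solution, then there is a maximal nest in $\mathcal{H}$ with respect to which $\mathcal{A}$ is upper triangular.
   Context: $\mathcal{H}$ is a complex Hilbert space. A dual operator algebra is a weak* closed complex linear subspace of $B(\mathcal{H})$ which is closed under products (not necessarily unital or self-adjoint). An operator algebra $\mathcal{B}$ is antisymmetric if $\mathcal{B}\cap\mathcal{B}^*$ is $\{0\}$ or $\mathbb{C}\cdot I$. A closed subspace $\mathcal{E}\subseteq\mathcal{H}$ is invariant for $\mathcal{A}$ if $A(\mathcal{E})\subseteq\mathcal{E}$ for all $A\in\mathcal{A}$; it is semi-invariant if $\mathcal{E}=\mathcal{E}_1\cap\mathcal{E}_2^\perp$ for some invariant subspaces $\mathcal{E}_2\subseteq\mathcal{E}_1$. If $P$ is the orthogonal projection onto a semi-invariant subspace $\mathcal{E}$, the weak* closure $\overline{P\mathcal{A}P}^{wk*}\subseteq B(\mathcal{E})$ is called a subquotient of $\mathcal{A}$. $\mathcal{A}$ is hereditarily antisymmetric if every subquotient of $\mathcal{A}$ is antisymmetric (in $B(\mathcal{E})$). The transitive algebra problem asks whether, for every complex Hilbert space $\mathcal{K}$ of dimension greater than $1$, every dual operator algebra properly contained in $B(\mathcal{K})$ has a nontrivial invariant subspace (an invariant closed subspace other than $\{0\}$ and $\mathcal{K}$); a positive solution means that the answer is yes. A nest in $\mathcal{H}$ is a family of closed subspaces totally ordered by inclusion; it is maximal if it is not properly contained in any other nest. $\mathcal{A}$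 is upper triangular for a nest if each subspace in the nest is invariant for $\mathcal{A}$. *)

(* Defs.v *)
From HB Require Import structures.
From mathcomp Require Import all_boot all_order all_algebra.
From mathcomp Require Import sesquilinear complex.
From mathcomp Require Import all_classical all_reals all_analysis.

Set Implicit Arguments.
Unset Strict Implicit.
Unset Printing Implicit Defensive.

Import Order.TTheory GRing.Theory Num.Theory.
Import numFieldNormedType.Exports.

Local Open Scope classical_set_scope.
Local Open Scope ring_scope.

HB.mixin Record CompleteNormed_isHilbert (R : realType) V
    & CompleteNormedModule R[i] V := {
  dotp : {dot V for Num.conj} ;
  dotp_norm : forall x : V, dotp x x = `|x| ^+ 2
}.

(* Complex Hilbert spaces. Norms take their values in R[i]; the inner product
   is linear in its first argument. *)
#[short(type="hilbertType")]
HB.structure Definition Hilbert (R : realType) :=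
  {V of CompleteNormedModule R[i] V & CompleteNormed_isHilbert R V}.

Notation "'[ x , y ]" := (dotp x y) : ring_scope.

Section closed_subspaces.
Context {R : realType}.

Record closedSubspace (H : hilbertType R) := ClosedSubspace {
  csub :> set H ;
  csub0 : csub 0 ;
  csubZD : forall (a : R[i]) (x y : H), csub x -> csub y -> csub (a *: x + y) ;
  csub_closed : closed csub
}.

Definition orth (H : hilbertType R) (E : set H) : set H :=
  [set x | forall y, E y -> '[x, y] = 0].

(* The orthogonal projection onto E: y is uniquely determined by the condition,
   and exists for every x since H is complete and E is closed. *)
Definition orthproj (H : hilbertType R) (E : closedSubspace H) (x : H) : H :=
  xget 0 [set y | csub E y /\ orth E (x - y)].

End closed_subspaces.

Section subspace_as_hilbert.
Context {R : realType} {H : hilbertType R} (E : closedSubspace H).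

Definition csub_pred : {pred H} := fun x => x \in (E : set H).

Lemma csub_submod_closed : submod_closed csub_pred.
Proof.
split=> [|a x y]; rewrite !inE; [exact: csub0 | exact: csubZD].
Qed.

HB.instance Definition _ :=
  GRing.isSubmodClosed.Build R[i] H csub_pred csub_submod_closed.

Record csub_type := CsubType { csub_val :> H ; csub_valP : csub_val \in csub_pred }.

HB.instance Definition _ := [isSub for csub_val].
HB.instance Definition _ := [Choice of csub_type by <:].
HB.instance Definition _ := [SubChoice_isSubLmodule of csub_type by <:].

Lemma csub_norm_eq0 (x : csub_type) : `|csub_val x| = 0 -> x = 0.
Proof. by move=> /normr0_eq0 x0; exact: val_inj. Qed.

HB.instance Definition _ := Lmodule_isNormed.Build R[i] csub_type
  (fun x y => ler_normD (csub_val x) (csub_val y))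
  (fun (a : R[i]) (x : csub_type) => normrZ a (csub_val x))
  csub_norm_eq0.

Lemma csub_ballE (x : csub_type) (e : R[i]) :
  ball x e = csub_val @^-1` ball (csub_val x) e.
Proof. by rewrite -!ball_normE. Qed.

Lemma csub_complete (F : set_system csub_type) :
  ProperFilter F -> cauchy F -> cvg F.
Proof.
move=> FF Fc.
have cF : cauchy (csub_val @ F).
  apply/cauchy_ballP => e e0; move/cauchy_ballP : Fc => /(_ e e0).
  move=> [[A B] /= [FA FB] AB].
  exists (csub_val @` A, csub_val @` B).
    by split; [apply: filterS FA | apply: filterS FB] => x Ax; exists x.
  move=> [_ _] /= [[x Ax <-] [y By <-]].
  by have := AB (x, y) (conj Ax By); rewrite /= csub_ballE.
have /cvg_ex[l Fl] := @cauchy_cvg H _ (fmap_proper_filter _ FF) cF.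
have El : csub E l.
  apply: (@closed_cvg _ _ _ _ csub_val (csub E) (@csub_closed _ _ E) _ _ Fl).
  by apply: nearW => x; move: (csub_valP x); rewrite inE.
have El' : l \in csub_pred by rewrite inE.
apply/cvg_ex; exists (CsubType El').
apply/cvg_ballP => e e0; move/cvg_ballP : Fl => /(_ e e0).
by apply: filterS => x; rewrite csub_ballE.
Qed.

HB.instance Definition _ := Uniform_isComplete.Build csub_type csub_complete.

Definition csub_dot (x y : csub_type) : R[i] := '[csub_val x, csub_val y].

Lemma csub_dot_bilinear :
  bilinear_for *%R (Num.conj \; *%R) csub_dot.
Proof.
by split=> u a x y; rewrite /csub_dot /= ?linearPl ?linearPr.
Qed.

HB.instance Definition _ := bilinear_isBilinear.Build _ _ _ _ _ _ csub_dot
  csub_dot_bilinear.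
HB.instance Definition _ := isHermitianSesquilinear.Build _ _ _ _ csub_dot
  (fun x y => hermitian_subproof (csub_val x) (csub_val y)).

Lemma csub_dot_gt0 (x : csub_type) : x != 0 -> 0 < csub_dot x x.
Proof. by move=> x0; exact: neq0_dnorm_gt0. Qed.

HB.instance Definition _ := isDotProduct.Build _ _ csub_dot csub_dot_gt0.

Lemma csub_dot_norm (x : csub_type) :
  (csub_dot : {dot csub_type for Num.conj}) x x = `|x| ^+ 2.
Proof. exact: dotp_norm. Qed.

HB.instance Definition _ := CompleteNormed_isHilbert.Build R csub_type csub_dot_norm.

End subspace_as_hilbert.

Arguments csub_type {R H} E.

Section bounded_operators.
Context {R : realType} (H : hilbertType R).

Definition bounded_linear_operator (T : H -> H) : Prop :=
  linear T /\ exists M : R[i], forall x, `|T x| <= M * `|x|.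

Definition bop_pred : {pred H -> H} := fun T => `[< bounded_linear_operator T >].

Lemma bop_submod_closed : submod_closed bop_pred.
Proof.
split=> [|a S T /asboolP[linS [M SM]] /asboolP[linT [N TN]]]; apply/asboolP.
  split=> [b x y|]; first by rewrite scaler0 addr0.
  by exists 0 => x; rewrite normr0 mul0r.
split=> [b x y|].
  rewrite !fctE linS linT !scalerDr !scalerA [a * b]mulrC -!addrA.
  by congr (_ + _); rewrite addrCA.
exists (`|a| * M + N) => x; rewrite !fctE mulrDl -mulrA.
by rewrite (le_trans (ler_normD _ _))// lerD// normrZ ler_wpM2l.
Qed.

HB.instance Definition _ :=
  GRing.isSubmodClosed.Build R[i] (H -> H) bop_pred bop_submod_closed.

Record bop := Bop { bop_val :> H -> H ; bop_valP : bop_val \in bop_pred }.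

HB.instance Definition _ := [isSub for bop_val].
HB.instance Definition _ := [Choice of bop by <:].
HB.instance Definition _ := [SubChoice_isSubLmodule of bop by <:].

Lemma bop1_proof : (idfun : H -> H) \in bop_pred.
Proof. by apply/asboolP; split=> //; exists 1 => x; rewrite mul1r. Qed.

Definition bop1 : bop := Bop bop1_proof.

Lemma bopM_proof (S T : bop) : (S \o T : H -> H) \in bop_pred.
Proof.
case: S T => [S /= /asboolP[linS [M SM]]] [T /= /asboolP[linT [N TN]]].
apply/asboolP; split=> [a x y|]; first by rewrite /= linT linS.
exists (`|M| * N) => x /=; rewrite -mulrA.
apply: le_trans (ler_wpM2l (normr_ge0 M) (TN x)).
rewrite -[`|T x|]normr_id -normrM ger0_norm ?SM//.
exact: le_trans (normr_ge0 _) (SM _).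
Qed.

Definition bopM (S T : bop) : bop := Bop (bopM_proof S T).

Definition sqsummable (u : nat -> H) : Prop :=
  cvgn (series (fun n => `|u n| ^+ 2 : R[i]^o)).

(* For square summable u and v, these functionals are exactly the elements of
   the predual of B(H) (the trace class operators). *)
Definition normal_form (u v : nat -> H) (T : bop) : R[i]^o :=
  limn (series (fun n => '[T (u n), v n] : R[i]^o)).

Definition sqsummable_pair : Type :=
  {uv : (nat -> H) * (nat -> H) | sqsummable uv.1 /\ sqsummable uv.2}.

Definition normal_forms (T : bop) : {ptws sqsummable_pair -> R[i]^o} :=
  fun uv => normal_form (sval uv).1 (sval uv).2 T.

(* B(H) with its weak* (ultraweak) topology. *)
Definition bop_weakstar : Type := initial_topology normal_forms.
HB.instance Definition _ := Topological.on bop_weakstar.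

End bounded_operators.

Notation "''B' ( H )" := (bop H) (format "''B' ( H )") : type_scope.

Section operator_algebras.
Context {R : realType}.
Implicit Types H K : hilbertType R.

Definition weakstar_closed H (A : set 'B(H)) : Prop :=
  closed (A : set (bop_weakstar H)).

Definition weakstar_closure H (A : set 'B(H)) : set 'B(H) :=
  closure (A : set (bop_weakstar H)).

Definition dual_operator_algebra H (A : set 'B(H)) : Prop :=
  [/\ A 0,
      forall (a : R[i]) S T, A S -> A T -> A (a *: S + T),
      forall S T, A S -> A T -> A (bopM S T)
    & weakstar_closed A].

Definition is_adjoint H (T S : 'B(H)) : Prop :=
  forall x y : H, '[T x, y] = '[x, S y].

(* B^* *)
Definition adjoint_set H (B : set 'B(H)) : set 'B(H) :=
  [set S | exists2 T, B T & is_adjoint T S].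

Definition antisymmetric_algebra H (B : set 'B(H)) : Prop :=
  B `&` adjoint_set B = [set 0] \/
  B `&` adjoint_set B = [set a *: bop1 H | a in [set: R[i]]].

Definition invariant_subspace H (A : set 'B(H)) (E : closedSubspace H) : Prop :=
  forall T : 'B(H), A T -> T @` (E : set H) `<=` E.

Definition semi_invariant H (A : set 'B(H)) (E : closedSubspace H) : Prop :=
  exists E1 E2 : closedSubspace H,
    [/\ invariant_subspace A E1, invariant_subspace A E2, (E2 : set H) `<=` E1
      & (E : set H) = E1 `&` orth E2].

(* P A P, as a set of operators on the Hilbert space E. *)
Definition compressions H (A : set 'B(H)) (E : closedSubspace H) :
    set 'B(csub_type E) :=
  [set S | exists2 T, A T &
     forall x : csub_type E, csub_val (S x) = orthproj E (T (csub_val x))].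

Definition subquotient H (A : set 'B(H)) (E : closedSubspace H) :
    set 'B(csub_type E) :=
  weakstar_closure (@compressions H A E).

Definition hereditarily_antisymmetric H (A : set 'B(H)) : Prop :=
  forall E : closedSubspace H,
    semi_invariant A E -> antisymmetric_algebra (@subquotient H A E).

Definition dim_gt1 (K : hilbertType R) : Prop :=
  exists x y : K, forall a b : R[i], a *: x + b *: y = 0 -> a = 0 /\ b = 0.

Definition nest H (N : set (closedSubspace H)) : Prop :=
  forall E F, N E -> N F ->
    (E : set H) `<=` F \/ (F : set H) `<=` E.

Definition maximal_nest H (N : set (closedSubspace H)) : Prop :=
  nest N /\ forall N', nest N' -> N `<=` N' -> N' = N.

Definition upper_triangular H (A : set 'B(H)) (N : set (closedSubspace H)) : Prop :=
  forall E, N E -> invariant_subspace A E.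

End operator_algebras.

Arguments compressions {R H} A E.
Arguments subquotient {R H} A E.

Definition transitive_algebra_problem (R : realType) : Prop :=
  forall K : hilbertType R, dim_gt1 K ->
  forall A : set 'B(K), dual_operator_algebra A -> A <> setT ->
  exists E : closedSubspace K,
    [/\ invariant_subspace A E, (E : set K) <> [set 0] & (E : set K) <> setT].

(* Main.v *)
Require Import Defs.
From mathcomp Require Import all_boot all_order all_algebra.
From mathcomp Require Import sesquilinear complex.
From mathcomp Require Import lra.
From mathcomp Require Import all_classical all_reals all_analysis.

(* Take a nest N which is maximal among the nests of A-invariant subspaces, and
   suppose that a closed subspace F outside N is comparable to all of N.  Let E1
   be the intersection of the members of N above F, and E2 the closed span of
   those below F: both are invariant, so by maximality they lie in N and
   E2 < F < E1.  Picking nonzero vectors in F orthogonal to E2 and in E1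
   orthogonal to F shows that E = E1 (-) E2 has dimension at least 2, hence the
   subquotient of A on E, being antisymmetric, is not all of B(E) (a rank one
   projection is self-adjoint but not scalar).  It is a dual operator algebra
   because multiplication is separately weak* continuous, so by the transitive
   algebra property it has a nontrivial invariant subspace G.  Then E2 + G is
   A-invariant and strictly between E2 and E1, which contradicts the maximality
   of N. *)

Set Implicit Arguments.
Unset Strict Implicit.
Unset Printing Implicit Defensive.

Import Order.TTheory GRing.Theory Num.Theory.
Import numFieldNormedType.Exports.

Local Open Scope classical_set_scope.
Local Open Scope ring_scope.

(** * Inner product identities and the Cauchy-Schwarz inequality *)

Section inner_product.
Context {R : realType} {H : hilbertType R}.
Implicit Types (x y z : H) (a : R[i]).

Lemma dotC x y : '[x, y] = Num.conj '[y, x].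
Proof. by rewrite (hermC (@dotp R H)) expr0 mul1r. Qed.

Lemma dotZl a x y : '[a *: x, y] = a * '[x, y].
Proof. by have := linearPl (@dotp R H) y a x 0; rewrite !addr0 linear0l addr0. Qed.

Lemma dotZr a x y : '[x, a *: y] = Num.conj a * '[x, y].
Proof. by rewrite dotC dotZl rmorphM [in RHS]dotC. Qed.

Lemma dot_eq0C x y : '[x, y] = 0 -> '[y, x] = 0.
Proof. by rewrite dotC => /eqP; rewrite conjC_eq0 => /eqP. Qed.

Lemma pythagoras x y : '[x, y] = 0 -> `|x + y| ^+ 2 = `|x| ^+ 2 + `|y| ^+ 2.
Proof. by move=> xy0; rewrite -!dotp_norm dnormD xy0 rmorph0 !addr0. Qed.

Lemma parallelogram x y :
  `|x + y| ^+ 2 + `|x - y| ^+ 2 = (`|x| ^+ 2 + `|y| ^+ 2) *+ 2.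
Proof. by rewrite -!dotp_norm dnormD dnormB mulr2n addrACA subrr addr0. Qed.

Lemma dot_component x y : '[x - ('[x, y] / `|y| ^+ 2) *: y, y] = 0.
Proof.
have [->|y0] := eqVneq y 0; first by rewrite linear0r.
by rewrite linearBl /= dotZl dotp_norm divfK ?subrr// expf_neq0// normr_eq0.
Qed.

Lemma pythagoras_component x y (c := '[x, y] / `|y| ^+ 2) :
  `|x| ^+ 2 = `|x - c *: y| ^+ 2 + `|c *: y| ^+ 2.
Proof.
by rewrite -pythagoras ?subrK// dotZr dot_component mulr0.
Qed.

(** By Pythagoras the component of [x] along [y] is no longer than [x]. *)
Lemma cauchy_schwarz x y : `|'[x, y]| <= `|x| * `|y|.
Proof.
have [->|y0] := eqVneq y 0; first by rewrite linear0r normr0 mulr_ge0.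
rewrite -ler_pdivrMr ?normr_gt0// -(ler_pXn2r (n := 2))// ?nnegrE ?divr_ge0//.
have -> : `|'[x, y]| / `|y| = `|('[x, y] / `|y| ^+ 2) *: y|.
  by rewrite normrZ normf_div normrX normr_id expr2 invfM mulrA divfK ?normr_eq0.
by rewrite [leRHS](pythagoras_component x y) lerDr exprn_ge0.
Qed.

End inner_product.

(** * Orthogonal projection onto a closed subspace *)

Section orthogonal_projection.
Context {R : realType} {H : hilbertType R}.
Local Open Scope complex_scope.
Implicit Types (x y z : H) (a : R[i]) (E : closedSubspace H).

Lemma csubD E x y : csub E x -> csub E y -> csub E (x + y).
Proof. by move=> Ex Ey; have := csubZD 1 Ex Ey; rewrite scale1r. Qed.

Lemma csubZ E a x : csub E x -> csub E (a *: x).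
Proof. by move=> Ex; have := csubZD a Ex (csub0 E); rewrite addr0. Qed.

Lemma csubB E x y : csub E x -> csub E y -> csub E (x - y).
Proof. by move=> Ex Ey; have := csubZD (-1) Ey Ex; rewrite scaleN1r addrC. Qed.

Section nearest_point.
Variables (E : closedSubspace H) (x : H).

(** Norms take values in [R[i]]; the real part makes the infimum in [R] available. *)
Let dist2 y : R := complex.Re (`|x - y| ^+ 2).

Let dist2E y : (dist2 y)%:C = `|x - y| ^+ 2.
Proof. by rewrite /dist2 RRe_real// ger0_real// exprn_ge0. Qed.

Let D : set R := [set dist2 y | y in (E : set H)].

Let D_inf : has_inf D.
Proof.
split; first by exists (dist2 0); exists 0 => //; exact: csub0.
by exists 0 => _ [y _ <-]; rewrite -ler0c dist2E exprn_ge0.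
Qed.

Let inf_le y : csub E y -> inf D <= dist2 y.
Proof. by move=> Ey; apply: ge_inf; [exact: D_inf.2|exists y]. Qed.

(* Minimizing vectors form a Cauchy filter, by the parallelogram identity. *)
Let near_min (e : R) : set H := [set y | csub E y /\ dist2 y < inf D + e].

Let F : set_system H := filter_from [set e : R | 0 < e] near_min.

Let F_proper : ProperFilter F.
Proof.
apply: filter_from_proper.
  apply: filter_from_filter; first by exists 1 => /=.
  move=> e f /= e0 f0; exists (Num.min e f); first by rewrite /= lt_min e0.
  move=> y [Ey yef]; split; split=> //; apply: (lt_le_trans yef);
    by rewrite lerD2l ge_min lexx ?orbT.
move=> e /= e0; have [_ [y Ey <-] ye] := inf_adherent e0 D_inf.
by exists y.
Qed.

(** The midpoint of [y] and [z] lies in [E], so its squared distance to [x] is at least [inf D]; the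
    parallelogram law for [x - y] and [x - z] gives the bound. *)
Let near_min_diam (e : R) y z : near_min e y -> near_min e z ->
  `|y - z| ^+ 2 < (e *+ 4)%:C.
Proof.
move=> [Ey ye] [Ez ze].
have := parallelogram (x - y) (x - z).
have -> : x - y - (x - z) = z - y by rewrite opprB addrC addrA subrK.
have -> : x - y + (x - z) = 2 *: (x - 2^-1 *: (y + z)).
  by rewrite scalerBr scalerA divff ?pnatr_eq0// scale1r scaler_nat mulr2n opprD
    addrACA.
set m := 2^-1 *: (y + z).
have dm : inf D <= dist2 m by apply: inf_le; apply/csubZ/csubD.
rewrite normrZ exprMn -!dist2E distrC => /(canRL (addKr _)) ->.
have -> : - (`|2| ^+ 2 * (dist2 m)%:C) + ((dist2 y)%:C + (dist2 z)%:C) *+ 2 =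
    (- (4 * dist2 m) + (dist2 y + dist2 z) *+ 2)%:C.
  by rewrite raddfD raddfN raddfMn raddfD /= rmorphM/= normr_nat -natrX rmorph_nat.
by rewrite ltcR; lra.
Qed.

Let F_cauchy : cauchy F.
Proof.
have FF := F_proper; apply: cauchy_exP => d d0.
(* Chosen so that [e *+ 4] is [d ^+ 2], matching the diameter bound. *)
pose e : R := complex.Re (d ^+ 2) / 4.
have d2E : d ^+ 2 = (e *+ 4)%:C.
  by rewrite -mulr_natr divfK// RRe_real// ger0_real// exprn_ge0// ltW.
have e0 : 0 < e.
  by have := exprn_gt0 2 d0; rewrite d2E (ltcR 0) pmulrn_lgt0.
have [_ [y Ey <-] ye] := inf_adherent e0 D_inf.
exists y; exists e => // z zF; rewrite -ball_normE /=.
rewrite -(ltr_pXn2r (n := 2))// ?nnegrE// ?ltW// d2E.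
by apply: near_min_diam => //; split.
Qed.

Lemma exists_nearest : exists2 y, csub E y & forall w, csub E w -> `|x - y| <= `|x - w|.
Proof.
have FF := F_proper; have /cvg_ex[l Fl] := @cauchy_cvg H _ FF F_cauchy.
exists l.
  have F1 : F (near_min 1) by exists 1 => //=.
  apply: (@closed_cvg _ _ F FF id (csub E) (@csub_closed _ _ E) _ l Fl).
  by apply: filterS F1 => y [].
move=> w Ew; apply/ler_addgt0Pr => d d0; have d20 : 0 < d / 2 by rewrite divr_gt0.
pose s := `|x - w| + d / 2.
have s0 : 0 < s by rewrite ltr_wpDl.
(* With this [e], the points of [near_min e] are those of [E] at distance less than [s] from [x];
   one of them is also within [d / 2] of [l]. *)
pose e : R := complex.Re (s ^+ 2) - inf D.
have sE : (inf D + e)%:C = s ^+ 2.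
  by rewrite addrC subrK RRe_real// ger0_real// exprn_ge0// ltW.
have e0 : 0 < e.
  rewrite subr_gt0 (le_lt_trans (inf_le Ew))//.
  rewrite -ltcR dist2E RRe_real ?ger0_real ?exprn_ge0 ?ltW//.
  by rewrite ltrXn2r// ltrDl.
have Fe : F (near_min e) by exists e.
have [|y [[Ey ys] ly]] := @filter_ex _ F _ (near_min e `&` ball l (d / 2)).
  by apply: filterI => //; apply: Fl; exact: nbhsx_ballx.
rewrite -[x - l](subrKA y) (le_trans (ler_normD _ _))//.
have ys' : `|x - y| < s.
  rewrite -(ltr_pXn2r (n := 2)) ?nnegrE //; last exact: ltW.
  by rewrite -sE -dist2E ltcR.
move: ly; rewrite -ball_normE /= distrC => ly.
rewrite (le_trans (ltW (ltrD ys' ly)))// /s -addrA.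
by rewrite -splitr.
Qed.

End nearest_point.

(** Moving the nearest point [y] by the component of [x - y] along [w] would bring it strictly
    closer to [x], unless that component vanishes. *)
Lemma exists_orthproj E x : exists y, csub E y /\ orth E (x - y).
Proof.
have [y Ey ymin] := exists_nearest E x; exists y; split=> // w Ew.
pose c := '[x - y, w] / `|w| ^+ 2.
have := ymin (y + c *: w) (csubD Ey (csubZ c Ew)).
rewrite -(ler_pXn2r (n := 2)) ?nnegrE// (pythagoras_component (x - y) w) -/c.
rewrite opprD addrA -subr_ge0 opprD addrA subrr sub0r oppr_ge0.
move=> cw0; have : `|c *: w| ^+ 2 == 0 by rewrite eq_le cw0 exprn_ge0.
rewrite sqrf_eq0 normr_eq0 scaler_eq0 => /orP[|/eqP->]; last by rewrite linear0r.
by rewrite mulf_eq0 invr_eq0 sqrf_eq0 normr_eq0 => /orP[/eqP//|/eqP->]; rewrite linear0r.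
Qed.

Lemma orthprojP E x : csub E (orthproj E x) /\ orth E (x - orthproj E x).
Proof. exact: (xgetPex 0 (exists_orthproj E x)). Qed.

Lemma orthprojE E x y : csub E y -> orth E (x - y) -> orthproj E x = y.
Proof.
move=> Ey xy; have [Ep xp] := orthprojP E x.
apply/eqP; rewrite -subr_eq0 -normr_eq0 -sqrf_eq0 -dotp_norm.
set p := orthproj E x in Ep xp *.
have Epy : csub E (p - y) by exact: csubB.
(* Both terms are orthogonal to [E], so [p - y], itself in [E], is orthogonal to itself. *)
have {1}-> : p - y = (x - y) - (x - p) by rewrite opprB [RHS]addrC addrA subrK.
by rewrite linearBl /= xy// xp// subrr.
Qed.

Lemma orthproj_id E x : csub E x -> orthproj E x = x.
Proof. by move=> Ex; apply: orthprojE => // y _; rewrite subrr linear0l. Qed.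

Lemma orthproj_orth E x : orth E x -> orthproj E x = 0.
Proof. by move=> Ex; apply: orthprojE; [exact: csub0|rewrite subr0]. Qed.

Lemma orthproj_linear E : linear (orthproj E).
Proof.
move=> a x y; have [Ex ox] := orthprojP E x; have [Ey oy] := orthprojP E y.
apply: orthprojE; first exact: csubZD.
move=> z Ez; rewrite opprD addrACA -scalerBr linearDl /= dotZl.
by rewrite ox// oy// mulr0 addr0.
Qed.

Lemma orthproj_norm E x : `|orthproj E x| <= `|x|.
Proof.
have [Ex ox] := orthprojP E x.
rewrite -(ler_pXn2r (n := 2)) ?nnegrE// -[in leRHS](subrK (orthproj E x) x).
by rewrite pythagoras ?ox// lerDr exprn_ge0.
Qed.

End orthogonal_projection.

(** * Bounded linear maps and the Riesz representation theorem *)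

Section bounded_maps.
Context {R : realType}.

(** A complex bound [M] can fail to be positive, for instance on the zero space; the new one can be
    divided by. *)
Lemma bound_gt0 (V W : normedModType R[i]) (f : V -> W) (M : R[i]) :
  (forall x, `|f x| <= M * `|x|) ->
  exists2 M' : R[i], 0 < M' & forall x, `|f x| <= M' * `|x|.
Proof.
move=> fM; exists (`|M| + 1) => [|x]; first by rewrite ltr_wpDl.
rewrite (le_trans (fM x))// -[leLHS]ger0_norm; last exact: le_trans (fM x).
by rewrite normrM normr_id ler_wpM2r// lerDl.
Qed.

Lemma linear_sub (V W : normedModType R[i]) (f : V -> W) :
  linear f -> forall x y, f (x - y) = f x - f y.
Proof. by move=> linf x y; rewrite addrC -scaleN1r linf scaleN1r addrC. Qed.

Lemma linear_scale (V W : normedModType R[i]) (f : V -> W) :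
  linear f -> forall a x, f (a *: x) = a *: f x.
Proof.
move=> linf a x; have := linf a x 0.
by rewrite addr0 -(subrr 0) linear_sub// subrr addr0.
Qed.

Lemma bounded_linear_cts (V W : normedModType R[i]) (f : V -> W) (M : R[i]) :
  linear f -> (forall x, `|f x| <= M * `|x|) -> continuous f.
Proof.
move=> linf /bound_gt0[{}M M0 fM] x; apply/cvgrPdist_lt => e e0.
have : \forall z \near x, `|x - z| < e / M.
  by apply: cvgr_dist_lt => //; rewrite divr_gt0.
apply: filterS => z; rewrite ltr_pdivlMr// mulrC; apply: le_lt_trans.
by rewrite -linear_sub.
Qed.

Lemma dotl_linear (H : hilbertType R) (y : H) :
  linear (fun x => '[x, y] : R[i]^o).
Proof. by move=> a x z; rewrite linearDl /= dotZl. Qed.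

Lemma dotl_continuous (H : hilbertType R) (y : H) :
  continuous (fun x => '[x, y] : R[i]^o).
Proof.
apply: (@bounded_linear_cts _ _ _ `|y|); first exact: dotl_linear.
by move=> x; rewrite mulrC; exact: cauchy_schwarz.
Qed.

Lemma bop_linear (H : hilbertType R) (T : 'B(H)) : linear T.
Proof. by case: T => T /= /asboolP[]. Qed.

Lemma bop_bounded (H : hilbertType R) (T : 'B(H)) :
  exists2 M : R[i], 0 < M & forall x, `|T x| <= M * `|x|.
Proof. by case: T => T /= /asboolP[_ [M]]; exact: bound_gt0. Qed.

Lemma bop_continuous (H : hilbertType R) (T : 'B(H)) : continuous T.
Proof.
by have [M _ TM] := bop_bounded T; apply: bounded_linear_cts TM; exact: bop_linear.
Qed.

Section kernel.
Variables (H : hilbertType R) (f : H -> R[i]^o).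
Hypotheses (linf : linear f) (ctsf : continuous f).

Let kerf0 : [set x | f x = 0] 0.
Proof. by rewrite /= -(subrr 0) linear_sub// subrr. Qed.

Let kerfZD (a : R[i]) (x y : H) : [set x | f x = 0] x -> [set x | f x = 0] y ->
  [set x | f x = 0] (a *: x + y).
Proof. by rewrite /= => fx fy; rewrite linf fx fy scaler0 addr0. Qed.

Let kerf_closed : closed [set x | f x = 0].
Proof.
have -> : [set x | f x = 0] = f @^-1` [set 0] by [].
by apply: (continuous_closedP f).1 => //; apply: accessible_closed_set1;
  apply: hausdorff_accessible; exact: norm_hausdorff.
Qed.

Definition csub_ker : closedSubspace H :=
  ClosedSubspace kerf0 kerfZD kerf_closed.

(** With [z] a vector orthogonal to the kernel and [f z] nonzero, every [x] is a multiple of [z]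
    modulo the kernel, so pairing with a suitable multiple of [z] recovers [f]. *)
Lemma riesz : exists y, forall x, f x = '[x, y].
Proof.
have [f0|/existsNP[z0 fz0]] := pselect (forall x, f x = 0).
  by exists 0 => x; rewrite linear0r f0.
have [kz oz] := orthprojP csub_ker z0.
pose z := z0 - orthproj csub_ker z0; rewrite -/z in oz.
have fz : f z = f z0 by rewrite linear_sub// kz subr0.
have z_neq0 : z != 0.
  by apply/eqP => zE; apply: fz0; rewrite -fz zE -(subrr 0) linear_sub// subrr.
exists ((Num.conj (f z) / `|z| ^+ 2) *: z) => x.
pose c : R[i] := f x / f z.
have kx : csub csub_ker (x - c *: z).
  rewrite /= linear_sub// linear_scale// /GRing.scale/= divfK ?subrr// fz.
  exact/eqP.
have /eqP := dot_eq0C (oz _ kx); rewrite linearBl /= dotZl subr_eq0 => /eqP xz.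
rewrite dotZr xz dotp_norm rmorphM fmorphV rmorphXn /= conjCK.
rewrite [Num.conj `|z|]geC0_conj// mulrACA mulVf ?expf_neq0 ?normr_eq0// mulr1.
by rewrite mulrC divfK// fz; exact/eqP.
Qed.

End kernel.
End bounded_maps.

(** * Completeness of the complex numbers and dominated series *)

Section complex_series.
Context {R : realType}.
Local Open Scope complex_scope.

Lemma normc_le_ReIm (z : R[i]) :
  `|z| <= `|complex.Re z|%:C + `|complex.Im z|%:C.
Proof.
rewrite {1}[z]complexE (le_trans (ler_normD _ _))// normrM !normc_def /= !expr0n /=.
by rewrite expr1n add0r sqrtr1 mul1r !addr0 !sqrtr_sqr.
Qed.

Lemma normc_ge_Im (z : R[i]) : `|complex.Im z|%:C <= `|z|.
Proof.
by rewrite -[complex.Im z]opprK -ReiNIm normrN (le_trans (normc_ge_Re _))// normrM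
  complexiE normCi mulr1.
Qed.

(** Real and imaginary parts do not increase norms, so both images of [F] are Cauchy on [R]; their
    limits are recombined. *)
Lemma complex_cauchy_cvg (F : set_system R[i]^o) :
  ProperFilter F -> cauchy F -> cvg F.
Proof.
move=> FF /cauchy_ballP Fc.
have cvg_part (p : {additive R[i] -> R}) : (forall z, `|p z|%:C <= `|z|) ->
    cvg ((p : R[i]^o -> R^o) @ F).
  move=> p1; apply: (@cauchy_cvg R^o _ (fmap_proper_filter _ FF)).
  apply/cauchy_ballP => e e0.
  have := Fc e%:C; rewrite (ltcR 0) => /(_ e0).
  move=> [[A B] /= [FA FB] AB].
  exists (p @` A, p @` B).
    by split; [apply: filterS FA | apply: filterS FB] => x Ax; exists x.
  move=> [_ _] /= [[x Ax <-] [y By <-]].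
  have := AB (x, y) (conj Ax By); rewrite -!ball_normE /= -raddfB => xy.
  by rewrite -ltcR (le_lt_trans (p1 _)).
have /cvg_ex[/= a Fa] := cvg_part (@complex.Re R) (@normc_ge_Re R).
have /cvg_ex[/= b Fb] := cvg_part (@complex.Im R) normc_ge_Im.
apply/cvg_ex; exists (a +i* b); apply/cvg_ballP => e e0.
have eE : e = (complex.Re e)%:C by rewrite RRe_real// ger0_real// ltW.
have e20 : 0 < complex.Re e / 2 by rewrite divr_gt0// -(ltcR 0) -eE.
have /cvgrPdist_lt/(_ _ e20) Na := Fa; have /cvgrPdist_lt/(_ _ e20) Nb := Fb.
apply: filterS2 Na Nb => z /= za zb; rewrite -ball_normE /=.
rewrite (le_lt_trans (normc_le_ReIm _))// -raddfD /= eE ltcR [ltRHS]splitr.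
by rewrite ltrD//; case: z za zb.
Qed.

(** The bound forces every [v n] to be a nonnegative real, so the Cauchy criterion passes from [v]
    to [u]. *)
Lemma complex_series_dominated (u v : nat -> R[i]^o) :
  (forall n, `|u n| <= v n) -> cvgn (series v) -> cvgn (series u).
Proof.
move=> uv /cvg_cauchy/cauchy_seriesP cv.
apply: (complex_cauchy_cvg (F := series u @ \oo)); apply/cauchy_seriesP => e /cv.
apply: filterS => n /=; apply: le_lt_trans; rewrite (le_trans (ler_norm_sum _ _ _))//.
rewrite [leRHS]ger0_norm; first exact: ler_sum.
by apply: sumr_ge0 => i _; apply: le_trans (uv i).
Qed.

End complex_series.

(** * Continuity for the topology of pointwise convergence *)

Section pointwise_topology.
Context {I : Type} {V : topologicalType}.

Lemma ptws_eval_continuous (i : I) : continuous (fun f : {ptws I -> V} => f i).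
Proof.
move=> f A fA; have /cvg_sup/(_ i) ff : nbhs f --> f by exact: cvg_id.
by apply: ff; exact: (@initial_continuous _ _ (fun g : {ptws I -> V} => g i) f A fA).
Qed.

Lemma ptws_continuous (X : topologicalType) (g : X -> {ptws I -> V}) :
  (forall i, continuous (fun x => g x i)) -> continuous g.
Proof.
move=> gc x; apply/cvg_sup => i A [_ [[B oB <-] Bgx BA]].
apply: (@filterS _ (nbhs x) _ (fun y => B (g y i))) => [y By|]; first exact: BA.
by apply: gc; exact: open_nbhs_nbhs.
Qed.

End pointwise_topology.

(** * The weak* topology and separate continuity of the operations *)

Section weakstar.
Context {R : realType} {H : hilbertType R}.

(** Riesz gives [Sa y], and Cauchy-Schwarz on ['[S (Sa y), y]] bounds it. The bound makes [Sa]
    preserve square summability. *)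
Lemma adjoint_exists (S : 'B(H)) : exists Sa : H -> H,
  (forall x y, '[S x, y] = '[x, Sa y]) /\
  exists M : R[i], forall y, `|Sa y| <= M * `|y|.
Proof.
have Sa_ex y : exists z, forall x, '[S x, y] = '[x, z].
  apply: (riesz (f := fun x => '[S x, y])).
    by move=> a x z; rewrite bop_linear dotl_linear.
  by move=> x; apply: (@continuous_comp _ _ _ S (fun z => '[z, y] : R[i]^o) x);
    [exact: bop_continuous|exact: dotl_continuous].
have [Sa SaE] := choice Sa_ex; exists Sa; split=> //.
have [M M0 SM] := bop_bounded S; exists M => y.
have [->|y0] := eqVneq (Sa y) 0; first by rewrite normr0 mulr_ge0// ltW.
rewrite -(ler_pM2l (x := `|Sa y|)) ?normr_gt0// -expr2 -dotp_norm -SaE.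
rewrite -[leLHS]ger0_norm; last by rewrite SaE dotp_norm exprn_ge0.
rewrite (le_trans (cauchy_schwarz _ _))// mulrA [_ * M]mulrC ler_wpM2r//.
Qed.

Lemma sqsummable_bounded (f : H -> H) (M : R[i]) (u : nat -> H) :
  (forall x, `|f x| <= M * `|x|) -> sqsummable u -> sqsummable (f \o u).
Proof.
move=> /bound_gt0[{}M M0 fM] su.
apply: (@complex_series_dominated _ _ (fun n => M ^+ 2 *: (`|u n| ^+ 2 : R[i]^o))).
  move=> n /=; rewrite normrX normr_id /GRing.scale/= -exprMn.
  by rewrite ler_pXn2r ?nnegrE ?mulr_ge0 ?(ltW M0)//; exact: fM.
exact: is_cvg_seriesZ.
Qed.

Lemma is_cvg_normal_form (u v : nat -> H) (T : 'B(H)) :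
  sqsummable u -> sqsummable v ->
  cvgn (series (fun n => '[T (u n), v n] : R[i]^o)).
Proof.
have [M M0 TM] := bop_bounded T => su sv.
have sTu := sqsummable_bounded TM su.
apply: (complex_series_dominated
  (v := fun n => (`|T (u n)| ^+ 2 + `|v n| ^+ 2 : R[i]^o))).
  move=> n; rewrite (le_trans (cauchy_schwarz _ _))//.
  (* For nonnegative [p] and [q], this yields [p * q <= 2 * p * q <= p ^+ 2 + q ^+ 2]. *)
  have : 0 <= (`|T (u n)| - `|v n|) ^+ 2.
    by rewrite -realEsqr// realB.
  rewrite sqrrB addrAC subr_ge0; apply: le_trans.
  by rewrite mulr2n lerDl mulr_ge0.
exact: (is_cvg_seriesD sTu sv).
Qed.

Lemma normal_form_linear (u v : nat -> H) : sqsummable u -> sqsummable v ->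
  linear (normal_form u v).
Proof.
move=> su sv a S T; rewrite /normal_form.
have cS := is_cvg_normal_form (T := S) su sv; have cT := is_cvg_normal_form (T := T) su sv.
apply: cvg_lim; first exact: norm_hausdorff.
have -> : series (fun n => '[(a *: S + T) (u n), v n] : R[i]^o) =
    (fun n => a *: (series (fun n => '[S (u n), v n] : R[i]^o) n : R[i]^o) +
              series (fun n => '[T (u n), v n] : R[i]^o) n).
  apply/funext => n; rewrite /series /= scaler_sumr -big_split /=.
  by apply: eq_bigr => k _; exact: dotl_linear.
exact: cvgD (cvgZr cS) cT.
Qed.

(** A normal form is one coordinate of the map [normal_forms] inducing the topology. *)
Lemma normal_form_continuous (u v : nat -> H) : sqsummable u -> sqsummable v ->
  continuous (normal_form u v : bop_weakstar H -> R[i]^o).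
Proof.
move=> su sv T.
pose uv : sqsummable_pair H := exist _ (u, v) (conj su sv).
pose W := {ptws sqsummable_pair H -> R[i]^o}.
have nfc : continuous ((@normal_forms R H) : bop_weakstar H -> W).
  exact: initial_continuous.
exact: (@continuous_comp (bop_weakstar H) W R[i]^o (@normal_forms R H)
  (fun g => g uv) T (nfc T) (@ptws_eval_continuous _ _ uv _)).
Qed.

(** The universal property of the initial topology. *)
Lemma weakstar_continuous (f : bop_weakstar H -> bop_weakstar H) :
  (forall u v, sqsummable u -> sqsummable v ->
    continuous (normal_form u v \o f : bop_weakstar H -> R[i]^o)) ->
  continuous f.
Proof.
move=> fc.
pose W := {ptws sqsummable_pair H -> R[i]^o}.
have nfc : continuous ((@normal_forms R H \o f) : bop_weakstar H -> W).
  apply: (@ptws_continuous (sqsummable_pair H) R[i]^o (bop_weakstar H)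
    (@normal_forms R H \o f)).
  move=> [[u v] [su sv]].
  exact: (fc u v su sv).
apply/continuousP => _ [B oB <-]; rewrite -comp_preimage.
by move/continuousP : nfc; apply.
Qed.

Lemma weakstar_continuous_linear (a : R[i]) (T : 'B(H)) :
  continuous ((fun S => a *: S + T) : bop_weakstar H -> bop_weakstar H).
Proof.
apply: weakstar_continuous => u v su sv S.
have -> : normal_form u v \o (fun S => a *: S + T) =
  (fun S => a *: normal_form u v S + normal_form u v T).
  by apply/funext => S' /=; rewrite normal_form_linear.
exact: cvgD (cvgZr (@normal_form_continuous u v su sv S)) (cvg_cst _).
Qed.

Lemma weakstar_continuous_add (T : 'B(H)) :
  continuous ((fun S => T + S) : bop_weakstar H -> bop_weakstar H).
Proof.
have -> : (fun S : bop_weakstar H => T + S) = (fun S => 1 *: S + T).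
  by apply/funext => S; rewrite scale1r addrC.
exact: (@weakstar_continuous_linear 1 T).
Qed.

(** Right multiplication by [T] turns the normal form of [u] and [v] into that of [T \o u] and
    [v]. *)
Lemma weakstar_continuous_mulr (T : 'B(H)) :
  continuous ((fun S => bopM S T) : bop_weakstar H -> bop_weakstar H).
Proof.
apply: weakstar_continuous => u v su sv.
have [M M0 TM] := bop_bounded T.
have sTu := sqsummable_bounded TM su.
exact: (normal_form_continuous sTu sv).
Qed.

(** The adjoint moves [S] to the other side, giving the normal form of [u] and [Sa \o v]. *)
Lemma weakstar_continuous_mull (S : 'B(H)) :
  continuous ((fun T => bopM S T) : bop_weakstar H -> bop_weakstar H).
Proof.
apply: weakstar_continuous => u v su sv.
have [Sa [SaE [M SaM]]] := adjoint_exists S.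
have sSv := sqsummable_bounded SaM sv.
have -> : normal_form u v \o (fun T => bopM S T) = normal_form u (Sa \o v).
  apply/funext => T /=; congr (limn (series _)); apply/funext => n.
  exact: SaE.
exact: normal_form_continuous.
Qed.

(** Asking only that [f] send [A] into [closure B] allows successive use, one variable at a time. *)
Lemma continuous_closure (T : topologicalType) (f : T -> T) (A B : set T) :
  continuous f -> (forall x, A x -> closure B (f x)) ->
  forall x, closure A x -> closure B (f x).
Proof.
move=> fc AB x Ax; have cB := (continuous_closedP f).1 fc _ (@closed_closure _ B).
by have := closure_subset (AB : A `<=` f @^-1` closure B) Ax; rewrite -(closure_id _).1.
Qed.

(** Separate continuity is enough: [S] is passed to the closure with [T] fixed there, after which
    [T] is passed with [S] in [B]. *)
Lemma dual_closure (B : set 'B(H)) :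
  B 0 -> (forall (a : R[i]) S T, B S -> B T -> B (a *: S + T)) ->
  (forall S T, B S -> B T -> B (bopM S T)) ->
  dual_operator_algebra (weakstar_closure B).
Proof.
move=> B0 BZD BM; pose W := bop_weakstar H; split.
- exact: (@subset_closure W).
- move=> a S T clS clT.
  apply: (@continuous_closure W (fun S => a *: S + T) B B _ _ S clS).
    exact: weakstar_continuous_linear.
  move=> {clS}S BS.
  apply: (@continuous_closure W (fun T => a *: S + T) B B _ _ T clT).
    exact: weakstar_continuous_add.
  by move=> {clT}T BT; apply: (@subset_closure W); exact: BZD.
- move=> S T clS clT.
  apply: (@continuous_closure W (fun S => bopM S T) B B _ _ S clS).
    exact: weakstar_continuous_mulr.
  move=> {clS}S BS.
  apply: (@continuous_closure W (fun T => bopM S T) B B _ _ T clT).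
    exact: weakstar_continuous_mull.
  by move=> {clT}T BT; apply: (@subset_closure W); exact: BM.
- exact: closed_closure.
Qed.

End weakstar.

(** * Subquotients on semi-invariant subspaces *)

Section subquotients.
Context {R : realType}.

Section rank_one.
Variables (H : hilbertType R) (e : H).

Lemma rank_one_subproof : (fun x : H => '[x, e] *: e) \in @bop_pred R H.
Proof.
apply/asboolP; split=> [a x y|].
  by rewrite linearDl /= dotZl scalerDl scalerA.
exists (`|e| * `|e|) => x; rewrite normrZ mulrAC ler_wpM2r// mulrC.
exact: cauchy_schwarz.
Qed.

(** Up to the factor ['[e, e]], the orthogonal projection onto the line of [e]. *)
Definition rank_one : 'B(H) := Bop rank_one_subproof.

Lemma rank_one_adjoint : is_adjoint rank_one rank_one.
Proof. by move=> x y /=; rewrite dotZl dotZr -dotC mulrC. Qed.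

End rank_one.

(** The operator [rank_one x] is self-adjoint and nonzero. Were it a scalar [c], the multiple of [x]
    it takes at [y] would equal [c *: y], and independence would give [c = 0]. *)
Lemma antisymmetric_proper (H : hilbertType R) :
  dim_gt1 H -> ~ antisymmetric_algebra [set: 'B(H)].
Proof.
move=> [x [y xy]].
have x0 : x <> 0.
  move=> x0; have [/eqP] : (1 : R[i]) = 0 /\ (0 : R[i]) = 0.
    by apply: xy; rewrite x0 scaler0 scale0r addr0.
  by rewrite oner_eq0.
have T0 : rank_one x x <> 0.
  rewrite /= dotp_norm => /eqP; rewrite scaler_eq0 sqrf_eq0 normr_eq0 orbb.
  by move/eqP.
have Tin : ([set: 'B(H)] `&` adjoint_set setT) (rank_one x).
  by split=> //; exists (rank_one x) => //; exact: rank_one_adjoint.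
case=> TE; move: Tin; rewrite TE; first by move=> /= Tx; apply: T0; rewrite Tx.
move=> [c _ Tc]; have [_ /eqP] : '[y, x] = 0 /\ - c = 0.
  apply: xy; have : rank_one x y = c *: y by rewrite -Tc.
  by rewrite /= => ->; rewrite scaleNr subrr.
by rewrite oppr_eq0 => /eqP c0; apply: T0; rewrite -Tc c0 scale0r.
Qed.

Variable H : hilbertType R.
Implicit Types (E F : closedSubspace H) (A : set 'B(H)).

Lemma csub_inj E F : (E : set H) = F -> E = F.
Proof.
case: E F => [E E0 EZD Ec] [F F0 FZD Fc] /= EF; subst F.
by congr ClosedSubspace; exact: Prop_irrelevance.
Qed.

Section meet.
Variable P : set (closedSubspace H).
Local Notation meet := (\bigcap_(E in P) (E : set H)).

Let meet0 : meet 0. Proof. by move=> E _; exact: csub0. Qed.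

Let meetZD (a : R[i]) x y : meet x -> meet y -> meet (a *: x + y).
Proof. by move=> Px Py E PE; apply: csubZD; [exact: Px|exact: Py]. Qed.

Let meet_closed : closed meet.
Proof. by apply: closed_bigI => E _; exact: csub_closed. Qed.

(** For empty [P] this is the whole space. *)
Definition csub_meet : closedSubspace H := ClosedSubspace meet0 meetZD meet_closed.

Lemma csub_meetP x : csub csub_meet x <-> forall E, P E -> csub E x.
Proof. by []. Qed.

End meet.

Section preimage.
Variables (K : hilbertType R) (f : H -> K) (G : closedSubspace K).
Hypotheses (linf : linear f) (ctsf : continuous f).

Let pre : set H := f @^-1` G.

Let pre0 : pre 0.
Proof. by rewrite /pre/= -(subrr 0) linear_sub// subrr; exact: csub0. Qed.

Let preZD (a : R[i]) x y : pre x -> pre y -> pre (a *: x + y).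
Proof. by rewrite /pre/= linf; exact: csubZD. Qed.

Let pre_closed : closed pre.
Proof. by apply: (continuous_closedP f).1 => //; exact: csub_closed. Qed.

Definition csub_preimage : closedSubspace H :=
  ClosedSubspace pre0 preZD pre_closed.

End preimage.

(** An intersection of kernels of continuous functionals, hence closed by construction. *)
Definition csub_orth E : closedSubspace H :=
  csub_meet [set csub_ker (@dotl_linear R H y) (@dotl_continuous R H y) | y in (E : set H)].

Lemma csub_orthE E : (csub_orth E : set H) = orth E.
Proof.
apply/seteqP; split=> x Ex; first by move=> y Ey; exact: ((csub_meetP _ _).1 Ex _ (imageP _ Ey)).
by move=> _ [y Ey <-]; exact: Ex.
Qed.

Definition csub_diff E1 E2 : closedSubspace H := csub_meet [set E1; csub_orth E2].

Lemma csub_diffE E1 E2 : (csub_diff E1 E2 : set H) = E1 `&` orth E2.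
Proof. by rewrite /= bigcap_setU !bigcap_set1 csub_orthE. Qed.

Section restricted_projection.
Variable E : closedSubspace H.

Let proj_in x : orthproj E x \in csub_pred E.
Proof. by rewrite inE; have [] := orthprojP E x. Qed.

Definition projE (x : H) : csub_type E := CsubType (proj_in x).

Lemma projE_linear : linear projE.
Proof. by move=> a x y; apply: val_inj; exact: orthproj_linear. Qed.

Lemma projE_norm x : `|projE x| <= `|x|.
Proof. exact: orthproj_norm. Qed.

Lemma projE_continuous : continuous projE.
Proof.
apply: (@bounded_linear_cts _ _ _ _ 1); first exact: projE_linear.
by move=> x; rewrite mul1r; exact: projE_norm.
Qed.

Lemma projEK (x : csub_type E) : projE (csub_val x) = x.
Proof.
by apply: val_inj; apply: orthproj_id; have := csub_valP x; rewrite inE.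
Qed.

Variable T : 'B(H).

Lemma compress_subproof :
  (fun x : csub_type E => projE (T (csub_val x))) \in @bop_pred R (csub_type E).
Proof.
apply/asboolP; split=> [a x y|]; first by rewrite /= bop_linear projE_linear.
have [M M0 TM] := bop_bounded T; exists M => x.
exact: le_trans (projE_norm _) (TM _).
Qed.

Definition compress : 'B(csub_type E) := Bop compress_subproof.

End restricted_projection.

Section semi_invariant_part.
Variables (A : set 'B(H)) (E1 E2 : closedSubspace H).
Hypotheses (A0 : A 0) (AZD : forall (a : R[i]) S T, A S -> A T -> A (a *: S + T)).
Hypothesis AM : forall S T, A S -> A T -> A (bopM S T).
Hypotheses (inv1 : invariant_subspace A E1) (inv2 : invariant_subspace A E2).
Hypothesis E21 : (E2 : set H) `<=` E1.

Let E := csub_diff E1 E2.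

(** On [E1], projecting onto [E] amounts to subtracting the projection onto [E2]. *)
Lemma projE_sub (x : H) : csub E1 x -> csub E2 (x - csub_val (projE E x)).
Proof.
move=> E1x; have [Ep xp] := orthprojP E2 x.
suff -> : csub_val (projE E x) = x - orthproj E2 x by rewrite opprB addrC subrK.
apply: orthprojE => [|y].
  by rewrite csub_diffE; split=> //; apply: csubB => //; exact: E21.
rewrite csub_diffE opprB addrC subrK => -[_ Ey]; apply: dot_eq0C; exact: Ey.
Qed.

Lemma projE_kernel (x : H) : csub E2 x -> projE E x = 0.
Proof.
move=> E2x; apply: val_inj; apply: orthproj_orth => y.
by rewrite csub_diffE => -[_ Ey]; apply: dot_eq0C; exact: Ey.
Qed.

(** The compression is the action of [T] on the quotient of [E1] by [E2]: the component of [x] in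
    [E2] stays in [E2] under [T], where [projE] vanishes. *)
Lemma projE_compress (T : 'B(H)) (x : H) : A T -> csub E1 x ->
  projE E (T x) = compress E T (projE E x).
Proof.
move=> AT E1x; apply/eqP; rewrite -subr_eq0 /= -linear_sub; last exact: projE_linear.
rewrite -linear_sub; last exact: bop_linear.
by rewrite projE_kernel//; apply: (inv2 AT); exists (x - csub_val (projE E x)) => //; exact: projE_sub.
Qed.

Lemma compressionsE (S : 'B(csub_type E)) :
  compressions A E S <-> exists2 T, A T & S = compress E T.
Proof.
split=> -[T AT ST]; exists T => //; last by rewrite ST.
by apply: val_inj; apply/funext => x; apply: val_inj; exact: ST.
Qed.

(** Compression to a semi-invariant subspace is multiplicative, by the intertwining relation
    [projE_compress], so the compressions already form an algebra before closure. *)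
Lemma dual_subquotient : dual_operator_algebra (subquotient A E).
Proof.
apply: dual_closure.
- exists 0 => // x; rewrite [LHS]/=.
  by rewrite orthproj_id//; exact: csub0.
- move=> a S T [S' AS SS'] [T' AT TT']; exists (a *: S' + T'); first exact: AZD.
  by move=> x /=; rewrite SS' TT' orthproj_linear.
- move=> S T /compressionsE[S' AS ->] /compressionsE[T' AT ->].
  apply/compressionsE; exists (bopM S' T'); first exact: AM.
  apply: val_inj; apply/funext => x /=.
  have E1x : csub E1 x by have := csub_valP x; rewrite inE csub_diffE => -[].
  by rewrite [RHS]projE_compress//; apply: (inv1 AT); exists (csub_val x).
Qed.

(** A nontrivial invariant subspace [G] of the subquotient is pulled back to [E1] along [projE],
    which intertwines [T] with its compression. *)
Lemma invariant_between :
  (transitive_algebra_problem R) -> antisymmetric_algebra (subquotient A E) ->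
  dim_gt1 (csub_type E) ->
  exists F : closedSubspace H, [/\ invariant_subspace A F,
    (E2 : set H) `<=` F, (F : set H) `<=` E1, F <> E1 & F <> E2].
Proof.
move=> TAP antiE dimE.
have properE : subquotient A E <> setT.
  by move=> ET; apply: (antisymmetric_proper dimE); rewrite -ET.
have [G [invG G0 GT]] := TAP _ dimE _ dual_subquotient properE.
pose pG := csub_preimage G (@projE_linear E) (@projE_continuous E).
have sub1 (x : csub_type E) : csub E1 x.
  by have := csub_valP x; rewrite inE csub_diffE => -[].
(* F is E2 + G, written so as to be visibly closed. *)
pose F := csub_meet [set E1; pG].
have FE : (F : set H) = E1 `&` pG by rewrite /= bigcap_setU !bigcap_set1.
have G_F (x : csub_type E) : csub G x -> csub F x.
  by move=> Gx; rewrite FE; split; [exact: sub1|rewrite /= projEK].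
exists F; split.
- move=> T AT _ [x + <-]; rewrite FE => -[E1x Gx].
  have E1Tx : csub E1 (T x) by apply: (inv1 AT); exists x.
  split=> //=; rewrite projE_compress//.
  apply: (invG (compress E T)); last by exists (projE E x).
  by apply: subset_closure; apply/compressionsE; exists T.
- move=> x E2x; rewrite FE; split; first exact: E21.
  by rewrite /= projE_kernel//; exact: csub0.
- by rewrite FE => x [].
(* Since [projE] fixes [E], equality with [E1] would make [G] everything. *)
- move=> F1; apply: GT; apply/seteqP; split=> // x _.
  by have := sub1 x; rewrite -F1 FE => -[_]; rewrite /= projEK.
(* Equality with [E2] would put [G] in the kernel of [projE], yet [projE] fixes [G]. *)
- move=> F2; apply: G0; apply/seteqP; split=> [x Gx|_ ->]; last exact: csub0.
  by have := G_F x Gx; rewrite F2 => /projE_kernel; rewrite projEK.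
Qed.

End semi_invariant_part.

(** A nonzero vector of [F] orthogonal to [E2] and a nonzero vector of [E1] orthogonal to [F] are
    mutually orthogonal, hence independent. *)
Lemma dim_gt1_csub_diff E1 F E2 :
  (E2 : set H) `<=` F -> (F : set H) `<=` E1 -> F <> E1 -> F <> E2 ->
  dim_gt1 (csub_type (csub_diff E1 E2)).
Proof.
move=> E2F FE1 FneE1 FneE2.
have gap E E' : (E : set H) `<=` E' -> E <> E' ->
    exists2 x, csub E' x /\ orth E x & '[x, x] != 0.
  move=> EE' EneE'.
  have [x [E'x Ex]] : exists x, csub E' x /\ ~ csub E x.
    apply: contrapT => /forallNP noX; apply: EneE'; apply: csub_inj.
    apply/seteqP; split=> // x E'x; apply: contrapT => Ex.
    exact: (noX x (conj E'x Ex)).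
  have [Ep xp] := orthprojP E x; exists (x - orthproj E x).
    by split=> //; apply: csubB => //; exact: EE'.
  apply/eqP => /eqP; rewrite dnorm_eq0 subr_eq0 => /eqP xE.
  by apply: Ex; rewrite xE.
have [x [Fx E2x] x0] := gap _ _ E2F (nesym FneE2).
have [y [E1y Fy] y0] := gap _ _ FE1 FneE1.
have Dx : x \in csub_pred (csub_diff E1 E2).
  by rewrite inE csub_diffE; split=> //; exact: FE1.
have Dy : y \in csub_pred (csub_diff E1 E2).
  by rewrite inE csub_diffE; split=> // z E2z; apply: Fy; exact: E2F.
exists (CsubType Dx), (CsubType Dy) => a b /(congr1 (@csub_val _ _ _)) /= ab0.
have yx : '[y, x] = 0 by exact: Fy.
have xy : '[x, y] = 0 by exact: dot_eq0C.
have := congr1 (fun z => '[z, x]) ab0; have := congr1 (fun z => '[z, y]) ab0.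
rewrite !linearDl /= !dotZl xy yx !mulr0 add0r addr0 !linear0l.
by move=> /eqP + /eqP; rewrite !mulf_eq0 (negbTE x0) (negbTE y0) !orbF
  => /eqP-> /eqP->.
Qed.

End subquotients.

(** * Nests of invariant subspaces, and their meets and joins *)

Section invariant_nests.
Context {R : realType} {H : hilbertType R}.
Implicit Types (E F : closedSubspace H) (A : set 'B(H)).
Implicit Types N : set (closedSubspace H).

Definition comparable_to N F := forall E, N E ->
  (E : set H) `<=` F \/ (F : set H) `<=` E.

(** Zorn's lemma on nests of invariant subspaces; an [F] outside [N] satisfying the last two
    conditions could be adjoined to [N]. *)
Lemma exists_maximal_invariant_nest A : exists N : set (closedSubspace H),
  [/\ nest N, upper_triangular A N &
    forall F, invariant_subspace A F -> comparable_to N F -> N F].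
Proof.
have [|N [[nestN upN] maxN]] :=
    @Zorn_bigcup _ [set N | @nest R H N /\ upper_triangular A N].
  move=> C CP totC; split; last by move=> E [N CN NE]; exact: (CP N CN).2.
  move=> E F [N1 C1 E1] [N2 C2 F2].
  (* Both subspaces lie in the larger of the two nests, where they are comparable. *)
  have [N12|N21] := totC _ _ C1 C2.
    by apply: (CP _ C2).1 => //; exact: N12.
  by apply: (CP _ C1).1 => //; exact: N21.
exists N; split=> // F invF cmpF; apply: contrapT => NF.
apply: (maxN (N `|` [set F])).
  by split=> [E|NFN]; [left|apply: NF; apply: NFN; right].
split=> [E E'|E [|->//]]; last exact: upN.
move=> [NE|->] [NE'|->]; [exact: nestN|exact: cmpF| |by left].
by have [] := cmpF _ NE'; [right|left].
Qed.

Lemma invariant_meet A (P : set (closedSubspace H)) :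
  (forall E, P E -> invariant_subspace A E) -> invariant_subspace A (csub_meet P).
Proof.
move=> invP T AT _ [x /csub_meetP Px <-]; apply/csub_meetP => E PE; apply: (invP E PE T AT).
by exists x => //; exact: Px.
Qed.

(* The closed linear span of the members of P, obtained without taking closures. *)
Definition csub_join (P : set (closedSubspace H)) : closedSubspace H :=
  csub_meet [set L | forall E, P E -> (E : set H) `<=` L].

Lemma sub_join (P : set (closedSubspace H)) E : P E -> (E : set H) `<=` csub_join P.
Proof. by move=> PE x Ex; apply/csub_meetP => L PL; exact: PL Ex. Qed.

Lemma join_sub (P : set (closedSubspace H)) F :
  (forall E, P E -> (E : set H) `<=` F) -> (csub_join P : set H) `<=` F.
Proof. by move=> PF x /csub_meetP; apply. Qed.

(** The preimage of the join under [T] is a closed subspace containing each member of [P], hence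
    contains the join. *)
Lemma invariant_join A (P : set (closedSubspace H)) :
  (forall E, P E -> invariant_subspace A E) -> invariant_subspace A (csub_join P).
Proof.
move=> invP T AT _ [x /csub_meetP Px <-].
apply: (Px (csub_preimage (csub_join P) (@bop_linear _ _ T) (@bop_continuous _ _ T))).
move=> E PE y Ey /=; apply: (sub_join PE); apply: (invP E PE T AT).
by exists y.
Qed.

End invariant_nests.

Theorem corollary8p3 (R : realType) (H : hilbertType R) (A : set 'B(H))
    (dualA : dual_operator_algebra A)
    (antisymA : hereditarily_antisymmetric A)
    (TAP : transitive_algebra_problem R) :
  exists N : set (closedSubspace H), maximal_nest N /\ upper_triangular A N.
Proof.
have [N [nestN upN maxN]] := exists_maximal_invariant_nest A.
exists N; split=> //; split=> // N' nestN' NN'; apply/seteqP; split=> // F N'F.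
(* Membership of [F] in the larger nest is used only through this comparability; [F] itself may fail
   to be invariant. *)
have cmpF E : N E -> (E : set H) `<=` F \/ (F : set H) `<=` E.
  by move=> NE; apply: nestN' => //; exact: NN'.
pose E1 := csub_meet [set E | N E /\ (F : set H) `<=` E].
pose E2 := csub_join [set E | N E /\ (E : set H) `<=` F].
have FE1 : (F : set H) `<=` E1 by move=> x Fx; apply/csub_meetP => E [_]; apply.
have E2F : (E2 : set H) `<=` F by apply: join_sub => E [].
have inv1 : invariant_subspace A E1.
  by apply: invariant_meet => E [NE _]; exact: upN.
have inv2 : invariant_subspace A E2.
  by apply: invariant_join => E [NE _]; exact: upN.
have below E : N E -> (E : set H) `<=` F -> (E : set H) `<=` E2.
  by move=> NE EF; apply: sub_join.
have above E : N E -> (F : set H) `<=` E -> (E1 : set H) `<=` E.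
  by move=> NE FE x /csub_meetP; apply.
(* Members of [N] below [F] lie in [E2] and those above contain [E1], so [G] is comparable to all of
   them. *)
have between G : invariant_subspace A G -> (E2 : set H) `<=` G ->
    (G : set H) `<=` E1 -> N G.
  move=> invG E2G GE1; apply: maxN => // E NE; have [EF|FE] := cmpF E NE.
    by left; apply: subset_trans E2G; exact: below.
  by right; apply: (subset_trans GE1); exact: above.
have E21 : (E2 : set H) `<=` E1 := subset_trans E2F FE1.
apply: contrapT => NF.
(* By [between], both [E1] and [E2] belong to [N], whereas [F] does not. *)
have FneE1 : F <> E1 by move=> FE; apply: NF; rewrite FE; exact: between.
have FneE2 : F <> E2 by move=> FE; apply: NF; rewrite FE; exact: between.
have [A0 AZD AM _] := dualA.
have antiE : antisymmetric_algebra (subquotient A (csub_diff E1 E2)).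
  by apply: antisymA; exists E1, E2; rewrite csub_diffE.
have [G [invG E2G GE1 GneE1 GneE2]] :=
  invariant_between A0 AZD AM inv1 inv2 E21 TAP antiE
    (dim_gt1_csub_diff E2F FE1 FneE1 FneE2).
have NG := between G invG E2G GE1.
(* As a member of [N], [G] is below [F], hence equal to [E2], or above [F], hence equal to [E1]. *)
have [GF|FG] := cmpF G NG.
  by apply: GneE2; apply: csub_inj; apply/seteqP; split=> //; exact: below.
by apply: GneE1; apply: csub_inj; apply/seteqP; split=> //; exact: above.
Qed.
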